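(* Let $\mu:\mathcal{P}(\mathcal{C})\to L^*$ be a capacity and $f:\mathcal{C}\to L^*$ an input vector. Then $\int_{\mathrm{DPR},\mu}^{\otimes_D} f=*$ if and only if $\mu(\{i\in\mathcal{C}\mid f_i>_\ell *\})\le_\ell *$, $\mu(\{i\in\mathcal{C}\mid f_i\ge_\ell *\})\ge_\ell *$, and $f_i>_\ell 0$ for at least one $i\in\mathcal{C}$.
   Context: Residuated lattice: $L=(L,\wedge,\vee,\otimes,\to,0,1)$ is a linearly ordered residuated lattice: $(L,\wedge,\vee,0,1)$ is a linearly ordered lattice with bottom $0$ and top $1$ ($0\neq 1$), $(L,\otimes,1)$ is a commutative monoid, and $\alpha\otimes\beta\le\gamma$ iff $\alpha\le\beta\to\gamma$. The underlying ordered set of $L$ is either a closed real interval $[a,b]$ with $a<b$ or a finite subset of $[a,b]$ containing $a$ and $b$ (with $0,1$ denoting the bottom and top elements). Standing assumption: $L$ has no zero divisors with respect to $\otimes$, i.e. $\alpha\otimes\beta=0$ implies $\alpha=0$ or $\beta=0$. Dragonfly algebra: $L^*=L\cup\{*\}$ with $*\notin L$ (the ''unknown value''). Its linear order $\le_\ell$ extends the order of $L$ by $0<_\ell *<_\ell\alpha$ for all $\alpha\in L\setminus\{0\}$; $\wedge_D,\vee_D$ are the minimum and maximum with respect to $\le_\ell$, and $\bigwedge_D,\bigvee_D$ denote infimum and supremum with respect to $\le_\ell$ (with $\bigwedge_D\emptyset=1$, $\bigvee_D\emptyset=0$). The multiplication $\otimes_D$ on $L^*$ is: $\alpha\otimes_D\beta=\alpha\otimes\beta$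 for $\alpha,\beta\in L$; $*\otimes_D 0=0\otimes_D *=0$; $*\otimes_D\alpha=\alpha\otimes_D *=*$ for $\alpha\in L\setminus\{0\}$; $*\otimes_D *=*$. $\mathcal{C}=\{1,\dots,n\}$ is a finite non-empty set with power set $\mathcal{P}(\mathcal{C})$. An input vector is a map $f:\mathcal{C}\to L^*$, $f_i=f(i)$. A capacity is a map $\mu:\mathcal{P}(\mathcal{C})\to L^*$ with $\mu(\emptyset)=0$, $\mu(\mathcal{C})=1$, and $A\subseteq B\Rightarrow\mu(A)\le_\ell\mu(B)$. The multiplication-based qualitative integral is $$\int_{\mathrm{DPR},\mu}^{\otimes_D} f=\bigvee_{D,\,A\subseteq\mathcal{C}}\Big(\mu(A)\otimes_D\bigwedge_{D,\,i\in A}f_i\Big).$$ *)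

(* Defs.v *)
From HB Require Import structures.
From mathcomp Require Import all_boot all_order all_algebra.
From mathcomp Require Import all_classical all_reals.

Set Implicit Arguments.
Unset Strict Implicit.
Unset Printing Implicit Defensive.

Import Order.TTheory.

Local Open Scope order_scope.

(* The bounds 0 and 1 of the lattice are \bot and \top. *)
HB.mixin Record isResiduated (d : Order.disp_t) T of Order.TBTotal d T := {
  rmul : T -> T -> T;
  rimp : T -> T -> T;
  bot_neq_top : (\bot : T) != \top;
  rmulA : associative rmul;
  rmulC : commutative rmul;
  rmul1x : left_id \top rmul;
  rmul_adj : forall x y z : T, (rmul x y <= z) = (x <= rimp y z);
}.

#[short(type="residuatedChainType")]
HB.structure Definition ResiduatedChain (d : Order.disp_t) :=
  { T of Order.TBTotal d T & isResiduated d T }.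

Definition no_zero_divisors (d : Order.disp_t) (L : residuatedChainType d) :=
  forall x y : L, rmul x y = \bot -> x = \bot \/ y = \bot.

(* The carrier is regarded as a subset of R through the order embedding
   [incl]; being a subset of R is a property of the ordered set only. *)
Definition real_carrier (R : realType) (d : Order.disp_t)
    (L : residuatedChainType d) : Prop :=
  exists (a b : R) (incl : L -> R),
    [/\ (a < b)%R,
        forall x y : L, (incl x <= incl y)%R = (x <= y)
      & range incl = `[a, b]%classic \/
        [/\ finite_set (range incl), (range incl `<=` `[a, b])%classic,
            range incl a & range incl b]].

(* [Star] is the unknown value, placed by [dle] between \bot and all the other
   elements of L. *)
Inductive dragonfly (L : Type) : Type := Val of L | Star.
Arguments Star {L}.

Section DragonflyChoice.
Variable L : Type.

Definition dragonfly_option (x : dragonfly L) : option L :=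
  if x is Val a then Some a else None.

Definition option_dragonfly (x : option L) : dragonfly L :=
  if x is Some a then Val a else Star.

Lemma dragonfly_optionK : cancel dragonfly_option option_dragonfly.
Proof. by case. Qed.

End DragonflyChoice.

HB.instance Definition _ (L : choiceType) :=
  Choice.copy (dragonfly L) (can_type (@dragonfly_optionK L)).

Section DragonflyAlgebra.
Variables (d : Order.disp_t) (L : residuatedChainType d).

Definition dle (x y : dragonfly L) : bool :=
  match x, y with
  | Val a, Val b => a <= b
  | Val a, Star => a == \bot
  | Star, Val b => b != \bot
  | Star, Star => true
  end.

Definition dmul (x y : dragonfly L) : dragonfly L :=
  match x, y with
  | Val a, Val b => Val (rmul a b)
  | Val a, Star | Star, Val a => if a == \bot then Val \bot else Star
  | Star, Star => Star
  end.

Lemma dle_refl : reflexive dle.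
Proof. by case=> [a|] /=. Qed.

Lemma dle_anti : antisymmetric dle.
Proof.
case=> [a|] [b|] //=.
- by move/le_anti ->.
- by case: (a == _).
- by case: (b == _).
Qed.

Lemma dle_trans : transitive dle.
Proof.
case=> [b|] [a|] [c|] //=.
- exact: le_trans.
- by move=> ab /eqP b0; rewrite -lex0 -b0.
- by move=> b0 bc; apply: contra_neq b0 => c0; apply/eqP; rewrite -lex0 -c0.
- by move=> /eqP-> _; apply: le0x.
Qed.

Lemma dle_total : total dle.
Proof.
case=> [a|] [b|] //=.
- exact: le_total.
- by case: (a == _).
- by case: (b == _).
Qed.

HB.instance Definition _ :=
  Order.Le_isPOrder.Build d (dragonfly L) dle_refl dle_anti dle_trans.
HB.instance Definition _ :=
  Order.POrder_isTotal.Build d (dragonfly L) dle_total.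

Lemma dle0x (x : dragonfly L) : (Val \bot : dragonfly L) <= x.
Proof. by case: x => [a|]; rewrite /Order.le /= ?le0x ?eqxx. Qed.

Lemma dlex1 (x : dragonfly L) : x <= (Val \top : dragonfly L).
Proof.
by case: x => [a|]; rewrite /Order.le /= ?lex1 // eq_sym bot_neq_top.
Qed.

HB.instance Definition _ := Order.hasBottom.Build d (dragonfly L) dle0x.
HB.instance Definition _ := Order.hasTop.Build d (dragonfly L) dlex1.

End DragonflyAlgebra.

Section Integral.
Variables (d : Order.disp_t) (L : residuatedChainType d) (n : nat).

(* The n criteria are indexed from 0. *)
Record capacity (mu : {set 'I_n} -> dragonfly L) : Prop := Capacity {
  capacity0 : mu finset.set0 = \bot;
  capacityT : mu [set: 'I_n] = \top;
  capacityS : forall A B : {set 'I_n}, A \subset B -> mu A <= mu B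
}.

(* An empty \meet is \top, so that A = set0 contributes [dmul \bot \top]. *)
Definition dpr_integral (mu : {set 'I_n} -> dragonfly L)
    (f : 'I_n -> dragonfly L) : dragonfly L :=
  \join_(A : {set 'I_n}) dmul (mu A) (\meet_(i in A) f i).

End Integral.

(* Main.v *)
Require Import Defs.
From HB Require Import structures.
From mathcomp Require Import all_boot all_order all_algebra.
From mathcomp Require Import all_classical all_reals.

(** The integral equals [Star] exactly when it is [>= Star] and not [> Star],
    and each of these two conditions can be read off one value of [mu].
    Both [Star <= x] and [Star < x] define up-sets that turn the product
    [dmul] into a conjunction: they say that [x] is not the bottom,
    respectively that [x] is a nonzero element of [L], and [L] has no zero
    divisors.
    For any such predicate [p], the join satisfies [p] iff some [A] has
    [p (mu A)] and [p (f i)] for all [i] in [A]; by monotonicity of [mu] the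
    largest candidate [A], namely the set of all [i] with [p (f i)], decides
    ([upset_integral]).  The remaining condition, that some [f i] is
    nonzero, follows from the second one, because [mu] vanishes on the empty
    set. *)

Set Implicit Arguments.
Unset Strict Implicit.
Unset Printing Implicit Defensive.

Import Order.TTheory.

Local Open Scope order_scope.

Section UpsetPredicates.
Variables (d : Order.disp_t) (T : tbOrderType d) (p : pred T).
Hypothesis p_homo : forall x y, x <= y -> p x -> p y.

(** In a chain a finite join or meet is one of its terms or an empty bound, so
    an up-set sees joins as disjunctions and meets as conjunctions. *)
Lemma upset_join_big (I : finType) (P : pred I) (F : I -> T) :
  p \bot = false -> p (\join_(i | P i) F i) = [exists (i | P i), p (F i)].
Proof.
move=> p0; rewrite -big_orE; apply: big_morph => // x y.
case: (leP x y) => [|/ltW] /p_homo; first by case: (p x) => // ->.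
by case: (p y) => [->|]; rewrite ?orbT ?orbF.
Qed.

Lemma upset_meet_big (I : finType) (P : pred I) (F : I -> T) :
  p \top -> p (\meet_(i | P i) F i) = [forall (i | P i), p (F i)].
Proof.
move=> p1; rewrite -big_andE; apply: big_morph => // x y.
case: (leP x y) => [|/ltW] /p_homo; first by case: (p x) => // ->.
by case: (p y) => [->|]; rewrite ?andbT ?andbF.
Qed.

End UpsetPredicates.

Section StarThreshold.
Variables (d : Order.disp_t) (L : residuatedChainType d).
Implicit Types x y : dragonfly L.

Lemma lt_Star_Val (a : L) : (Star < Val a) = (a != \bot).
Proof. by rewrite lt_neqAle. Qed.

Lemma lt_bot_Star : (\bot : dragonfly L) < Star.
Proof. by rewrite lt_neqAle; apply/andP; split=> //; apply: eqxx. Qed.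

Lemma lt_Star_top : Star < (\top : dragonfly L).
Proof. by rewrite lt_Star_Val eq_sym bot_neq_top. Qed.

Lemma rmul0x (a : L) : rmul \bot a = \bot.
Proof. by apply/eqP; rewrite -lex0 rmul_adj le0x. Qed.

Lemma rmul_eq0 (a b : L) : no_zero_divisors L ->
  (rmul a b == \bot) = (a == \bot) || (b == \bot).
Proof.
move=> hnzd; apply/eqP/orP => [/hnzd[]->|[]/eqP->]; rewrite ?eqxx; auto.
  exact: rmul0x.
by rewrite rmulC rmul0x.
Qed.

(** The elements strictly above [Star] are the nonzero elements of [L], so
    on [L] this is the absence of zero divisors; any product involving [Star]
    is [Star] or the bottom. *)
Lemma lt_Star_dmul x y : no_zero_divisors L ->
  (Star < dmul x y) = (Star < x) && (Star < y).
Proof.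
move=> hnzd; case: x y => [a|] [b|] /=; rewrite ?ltxx ?andbF //.
- by rewrite !lt_Star_Val rmul_eq0 // negb_or.
- by case: ifP => _; rewrite ?lt_Star_Val ?eqxx ?ltxx.
- by case: ifP => _; rewrite ?lt_Star_Val ?eqxx ?ltxx.
Qed.

(** Being above [Star] is being distinct from the bottom, and [Star] multiplies
    like a nonzero element as far as reaching the bottom is concerned. *)
Lemma le_Star_dmul x y : no_zero_divisors L ->
  (Star <= dmul x y) = (Star <= x) && (Star <= y).
Proof.
move=> hnzd; case: x y => [a|] [b|]; rewrite /Order.le /= ?andbT //.
- by rewrite rmul_eq0 // negb_or.
- by case: eqP => _ //=; rewrite eqxx.
- by case: eqP => _ //=; rewrite eqxx.
Qed.

End StarThreshold.

(** A set [A] contributes a term satisfying [p] only if [p (f i)] holds for all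
    [i] in [A]; then [A] lies in the set on the right, where [mu] is at least
    as large, and that set is itself one of the candidates [A]. *)
Lemma upset_integral (d : Order.disp_t) (L : residuatedChainType d) (n : nat)
    (mu : {set 'I_n} -> dragonfly L) (f : 'I_n -> dragonfly L)
    (p : pred (dragonfly L)) :
  {homo mu : A B / A \subset B >-> A <= B} ->
  (forall x y, x <= y -> p x -> p y) -> p \bot = false -> p \top ->
  (forall x y, p (dmul x y) = p x && p y) ->
  p (dpr_integral mu f) = p (mu [set i | p (f i)]%SET).
Proof.
move=> mu_homo p_homo p0 p1 pM; rewrite upset_join_big //.
apply/exists_inP/idP => [[A _]|pmu].
  rewrite pM upset_meet_big // => /andP[pA /forall_inP pf].
  apply: p_homo pA; apply: mu_homo; apply/fintype.subsetP => i /pf.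
  by rewrite inE.
exists [set i | p (f i)]%SET => //; rewrite pM pmu upset_meet_big //=.
by apply/forall_inP => i; rewrite inE.
Qed.

Theorem theorem5 (R : realType) (d : Order.disp_t) (L : residuatedChainType d)
    (hL : real_carrier R L) (hnzd : no_zero_divisors L)
    (n : nat) (hn : (0 < n)%N)
    (mu : {set 'I_n} -> dragonfly L) (hmu : capacity mu)
    (f : 'I_n -> dragonfly L) :
  dpr_integral mu f = Star <->
  [/\ mu [set i | f i > Star]%SET <= Star,
      mu [set i | f i >= Star]%SET >= Star
    & exists i : 'I_n, f i > \bot].
Proof.
have gt_int : (Star < dpr_integral mu f) = (Star < mu [set i | f i > Star]%SET).
  apply: (@upset_integral _ _ _ _ _ (fun x => Star < x)).
  - exact: capacityS hmu.
  - by move=> x y xy /lt_le_trans; apply.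
  - by apply/negbTE; rewrite -leNgt le0x.
  - exact: lt_Star_top.
  - by move=> x y; apply: lt_Star_dmul.
have ge_int :
    (Star <= dpr_integral mu f) = (Star <= mu [set i | f i >= Star]%SET).
  apply: (@upset_integral _ _ _ _ _ (fun x => Star <= x)).
  - exact: capacityS hmu.
  - by move=> x y xy /le_trans; apply.
  - by apply/negbTE; rewrite -ltNge lt_bot_Star.
  - exact: lex1.
  - by move=> x y; apply: le_Star_dmul.
split=> [int_Star|[mu_gt mu_ge _]]; last first.
  by apply/le_anti; rewrite ge_int mu_ge leNgt gt_int -leNgt mu_gt.
have mu_ge : Star <= mu [set i | f i >= Star]%SET.
  by rewrite -ge_int int_Star.
split=> //; first by rewrite leNgt -gt_int int_Star ltxx.
have [E0|[i]] := set_0Vmem [set i | f i >= Star]%SET.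
  by move: mu_ge; rewrite E0 (capacity0 hmu) leNgt lt_bot_Star.
by rewrite inE => fi; exists i; apply: lt_le_trans fi; apply: lt_bot_Star.
Qed.
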